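(* Let $n\in\mathbb N$ and let $M=\{m_{ikj}\}_{i,k,j=1}^n$ be a three-dimensional matrix with complex entries. For any $1\le k\le n$, let $M(k)$ be the matrix $M(k)=\{m_{ikj}\}_{i,j=1}^n$. Then $$ \bigl\Vert M:\mathcal S^2_n\times\mathcal S^2_n\to\mathcal S^1_n\bigr\Vert=\sup_{1\le k\le n}\bigl\Vert M(k):M_n\to M_n\bigr\Vert . $$
   Context: $M_n$ is the space of $n\times n$ complex matrices with the operator norm $\|\cdot\|_\infty$ (as operators on $\ell^2_n$), and $\mathcal S^p_n$ is the same space with the Schatten $p$-norm; $E_{ij}$ are the matrix units. The three-dimensional matrix $M$ acts as the bilinear map (bilinear Schur multiplier) $$M(A,B)=\sum_{i,j,k=1}^n m_{ikj}a_{ik}b_{kj}E_{ij},\qquad A=\{a_{ij}\},\ B=\{b_{ij}\},$$ and $\Vert M:\mathcal S^2_n\times\mathcal S^2_n\to\mathcal S^1_n\Vert$ is its norm as a bilinear map. Each matrix $M(k)$ acts as the linear Schur multiplier $[M(k)](C)=\sum_{i,j=1}^n m_{ikj}c_{ij}E_{ij}$ for $C=\{c_{ij}\}$, and $\Vert M(k):M_n\to M_n\Vert$ is its norm as a linear map on $(M_n,\|\cdot\|_\infty)$. *)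

(* Defs.v *)
From HB Require Import structures.
From mathcomp Require Import all_boot all_order all_algebra.
From mathcomp Require Import complex.
From mathcomp Require Import all_classical all_reals all_analysis.

Set Implicit Arguments.
Unset Strict Implicit.
Unset Printing Implicit Defensive.

Import Order.TTheory GRing.Theory Num.Theory.

Local Open Scope ring_scope.
Local Open Scope classical_set_scope.
Local Open Scope complex_scope.
Local Open Scope sesquilinear_scope.

(* The norm of a linear map T : (U, NU) -> (V, NV). The norms are explicit
   arguments, since matrix types carry other norms by default. All uses are in
   finite dimension, where the supremum is over a bounded nonempty set. *)
Definition linear_norm (R : realType) (U V : Type) (NU : U -> R) (NV : V -> R)
    (T : U -> V) : R :=
  sup [set NV (T x) | x in [set x : U | NU x <= 1]].

Definition bilinear_norm (R : realType) (U V W : Type)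
    (NU : U -> R) (NV : V -> R) (NW : W -> R) (T : U -> V -> W) : R :=
  sup [set NW (T xy.1 xy.2) |
        xy in [set xy : U * V | NU xy.1 <= 1 /\ NV xy.2 <= 1]].

Definition l2norm (R : realType) (n : nat) (x : 'cV[R[i]]_n) : R :=
  Num.sqrt (\sum_(i < n) complex.Re `|x i ord0| ^+ 2).

Definition opnorm (R : realType) (n : nat) (A : 'M[R[i]]_n) : R :=
  linear_norm (@l2norm R n) (@l2norm R n) (mulmx A).

(* The eigenvalues of |A| = (A^* A)^(1/2), with multiplicity and in no
   particular order; Re only moves the (real) eigenvalues of A^* A to R. *)
Definition singular_value (R : realType) (n : nat) (A : 'M[R[i]]_n)
    (i : 'I_n) : R :=
  Num.sqrt (complex.Re (spectral_diag (A ^t* *m A) ord0 i)).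

Definition schatten_norm (R : realType) (n : nat) (p : R) (A : 'M[R[i]]_n) : R :=
  (\sum_(i < n) singular_value A i `^ p) `^ p^-1.

(* Indices are in the order m i k j, where k is the summed index. *)
Definition bilinear_schur (R : realType) (n : nat)
    (m : 'I_n -> 'I_n -> 'I_n -> R[i]) (A B : 'M[R[i]]_n) : 'M[R[i]]_n :=
  \sum_(i < n) \sum_(k < n) \sum_(j < n)
    (m i k j * A i k * B k j) *: delta_mx i j.

Definition schur_slice (R : realType) (n : nat)
    (m : 'I_n -> 'I_n -> 'I_n -> R[i]) (k : 'I_n) : 'M[R[i]]_n :=
  \matrix_(i < n, j < n) m i k j.

Definition linear_schur (R : realType) (n : nat) (S C : 'M[R[i]]_n) :
    'M[R[i]]_n :=
  \sum_(i < n) \sum_(j < n) (S i j * C i j) *: delta_mx i j.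

(* Main.v *)
Require Import Defs.
From mathcomp Require Import all_boot all_order all_algebra.
From mathcomp Require Import complex.
From mathcomp Require Import all_classical all_reals all_analysis.

Set Implicit Arguments.
Unset Strict Implicit.
Unset Printing Implicit Defensive.

Import Order.TTheory GRing.Theory Num.Theory.

Local Open Scope ring_scope.
Local Open Scope classical_set_scope.
Local Open Scope complex_scope.

(** The norm of S^1_n is dual to the operator norm under the bilinear pairing
<D, X> = sum_ij d_ij x_ij.  On one side |<D, X>| <= |D|_op |X|_1
([modulus_pairing_le]), and on the other side some D with |D|_op <= 1 gives
<D, X> = |X|_1 ([schatten1_attained]): D is the entrywise conjugate of the
partial isometry in the polar decomposition of X.

Expanding the pairing of D with M(A, B) and exchanging the sums so that k comes
first ([pairing_bilinear_schur]) shows that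
  <D, M(A, B)> = sum_k a_k^T [M(k)](D) b_k,
where a_k is the k-th column of A and b_k the transposed k-th row of B.  The
squares of |a_k| and of |b_k| sum to the squared S^2 norms of A and of B, since
the S^2 norm is the Frobenius norm ([schatten2_sqr]).  The two inequalities of
the theorem are read off this identity.

- Upper bound ([schatten1_bilinear_schur_le]): take D attaining |M(A, B)|_1.
  Each term is at most |M(k)| |a_k| |b_k|, and summing over k costs nothing,
  because sum_k |a_k| |b_k| <= 1 on the unit balls of S^2_n.

- Lower bound ([schur_norm_le]): for fixed k, let A have only its k-th column
  nonzero and B only its k-th row.  The identity reduces to u^T [M(k)](C) x with
  arbitrary u and x in the unit ball, and the supremum of these numbers over u and x
  is |[M(k)](C)|_op.  Duality bounds each of them by |M(A, B)|_1. *)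

(** * Suprema of nonnegative reals *)

(** Nonnegativity of [K] covers the empty set, whose supremum is 0 by
convention; this is what makes the theorem hold for [n = 0]. *)
Lemma sup_le_ge0 (R : realType) (S : set R) (K : R) :
  0 <= K -> ubound S K -> sup S <= K.
Proof.
move=> K0 SK; have [->|S0] := eqVneq S set0; first by rewrite sup0.
by apply: ge_sup => //; apply/set0P.
Qed.

Lemma sup_ge0 (R : realType) (S : set R) (K : R) :
  (forall x, S x -> 0 <= x) -> ubound S K -> 0 <= sup S.
Proof.
move=> S0 SK; have [->|/set0P[x Sx]] := eqVneq S set0; first by rewrite sup0.
by apply: le_trans (S0 _ Sx) _; apply: ub_le_sup => //; exists K.
Qed.

(** * The modulus of a complex number, as an element of R *)

(** The norm of [R[i]] takes its values in [R[i]]; the norms in play are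
real-valued. *)
Definition modulus (R : realType) (z : R[i]) : R := complex.Re `|z|.

Section Modulus.
Context {R : realType}.
Implicit Types z w : R[i].

Lemma modulusE z : (modulus z)%:C = `|z|.
Proof. by rewrite /modulus RRe_real // normr_real. Qed.

Lemma modulus_ge0 z : 0 <= modulus z.
Proof. by rewrite -ler0c modulusE. Qed.

Lemma modulusM z w : modulus (z * w) = modulus z * modulus w.
Proof. by apply: complexI; rewrite rmorphM /= !modulusE normrM. Qed.

Lemma modulus0 : modulus (0 : R[i]) = 0.
Proof. by apply: complexI; rewrite modulusE normr0. Qed.

Lemma modulus_real (x : R) : 0 <= x -> modulus x%:C = x.
Proof. by move=> x0; apply: complexI; rewrite modulusE ger0_norm // ler0c. Qed.

Lemma modulus_conj z : modulus (z^*)%R = modulus z.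
Proof. by apply: complexI; rewrite !modulusE norm_conjC. Qed.

Lemma modulus_sum (I : finType) (F : I -> R[i]) :
  modulus (\sum_i F i) <= \sum_i modulus (F i).
Proof.
rewrite -lecR modulusE rmorph_sum /=; apply: le_trans (ler_norm_sum _ _ _) _.
by apply: ler_sum => i _; rewrite modulusE.
Qed.

Lemma modulus_sqrC z : ((modulus z) ^+ 2)%:C = z * (z^*)%R.
Proof. by rewrite rmorphXn /= modulusE normCK. Qed.

End Modulus.

(** * The Euclidean norm *)

Section L2norm.
Local Open Scope sesquilinear_scope.
Context {R : realType} {n : nat}.
Implicit Types (x y : 'cV[R[i]]_n).

Lemma l2norm_ge0 x : 0 <= l2norm x.
Proof. exact: sqrtr_ge0. Qed.

Lemma l2norm_sqr x : l2norm x ^+ 2 = \sum_i modulus (x i ord0) ^+ 2.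
Proof.
by rewrite sqr_sqrtr // sumr_ge0 // => i _; rewrite exprn_ge0 // modulus_ge0.
Qed.

Lemma l2norm_sqrC x : ((l2norm x) ^+ 2)%:C = (x ^t* *m x) ord0 ord0.
Proof.
rewrite l2norm_sqr rmorph_sum mxE /=; apply: eq_bigr => i _.
by rewrite modulus_sqrC !mxE mulrC.
Qed.

Lemma l2norm0 : l2norm (0 : 'cV[R[i]]_n) = 0.
Proof.
apply/eqP; rewrite -sqrf_eq0 l2norm_sqr big1 // => i _.
by rewrite mxE modulus0 expr0n.
Qed.

Lemma l2normZ (a : R[i]) x : l2norm (a *: x) = modulus a * l2norm x.
Proof.
apply: (@pexpIrn _ 2) => //.
- by rewrite nnegrE l2norm_ge0.
- by rewrite nnegrE mulr_ge0 ?l2norm_ge0 ?modulus_ge0.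
rewrite exprMn !l2norm_sqr mulr_sumr; apply: eq_bigr => i _.
by rewrite mxE modulusM exprMn.
Qed.

Lemma modulus_le_l2norm x i : modulus (x i ord0) <= l2norm x.
Proof.
rewrite -(@ler_pXn2r _ 2) // ?nnegrE ?l2norm_ge0 ?modulus_ge0 //.
rewrite l2norm_sqr (bigD1 i) //= lerDl sumr_ge0 // => j _.
by rewrite exprn_ge0 // modulus_ge0.
Qed.

(** A crude bound, used only to see that the sets whose suprema are taken are
bounded. *)
Lemma l2norm_le_sum x : l2norm x <= \sum_i modulus (x i ord0).
Proof.
have s0 : 0 <= \sum_i modulus (x i ord0).
  by rewrite sumr_ge0 // => i _; exact: modulus_ge0.
rewrite -(@ler_pXn2r _ 2) // ?nnegrE ?l2norm_ge0 //.
rewrite l2norm_sqr expr2 mulr_suml; apply: ler_sum => i _.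
rewrite expr2 ler_wpM2l ?modulus_ge0 // (bigD1 i) //= lerDl sumr_ge0 // => j _.
exact: modulus_ge0.
Qed.

Lemma l2norm_eq0 x : l2norm x = 0 -> x = 0.
Proof.
move=> x0; apply/matrixP => i j; rewrite ord1 mxE; apply/eqP.
have := modulus_le_l2norm x i; rewrite x0 -lecR modulusE => h.
by rewrite -normr_le0.
Qed.

Lemma l2norm_conj x : l2norm (map_mx Num.conj x) = l2norm x.
Proof.
by congr Num.sqrt; apply: eq_bigr => i _; rewrite mxE -/(modulus _) modulus_conj.
Qed.

Lemma l2norm_isometry (U : 'M[R[i]]_n) x :
  U ^t* *m U = 1%:M -> l2norm (U *m x) = l2norm x.
Proof.
move=> U1; apply: (@pexpIrn _ 2) => //; rewrite ?nnegrE ?l2norm_ge0 //.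
apply: complexI; rewrite !l2norm_sqrC trmx_mul map_mxM /= mulmxA.
by rewrite -(mulmxA _ _ U) U1 mulmx1.
Qed.

Lemma l2norm_delta (i : 'I_n) : l2norm (delta_mx i ord0 : 'cV[R[i]]_n) = 1.
Proof.
apply: (@pexpIrn _ 2) => //; rewrite ?nnegrE ?l2norm_ge0 //.
rewrite l2norm_sqr (bigD1 i) //= big1 ?addr0; last first.
  by move=> j ji; rewrite mxE (negPf ji) modulus0 expr0n.
by rewrite mxE !eqxx modulus_real.
Qed.

Lemma l2norm_normalize x : l2norm x != 0 ->
  l2norm (((l2norm x)^-1)%:C *: x) = 1.
Proof.
by move=> x0; rewrite l2normZ modulus_real ?mulVf // invr_ge0 l2norm_ge0.
Qed.

(** The left-hand side has no conjugate, so it is the Hermitian product of [x]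
with the conjugate of [y], which has the same norm as [y]. *)
Lemma l2norm_Cauchy_Schwarz x y :
  modulus (\sum_i x i ord0 * y i ord0) <= l2norm x * l2norm y.
Proof.
rewrite -(@ler_pXn2r _ 2) // ?nnegrE ?mulr_ge0 ?l2norm_ge0 ?modulus_ge0 //.
rewrite exprMn -lecR rmorphXn /= modulusE.
rewrite -(l2norm_conj y).
have E (a b : 'cV[R[i]]_n) : dotmx a^T b^T = \sum_i a i ord0 * ((b i ord0)^*)%R.
  by rewrite dotmxE mxE; apply: eq_bigr => i _; rewrite !mxE.
have /= [+ _] := @CauchySchwarz R[i] _ (@dotmx _ n) x^T (map_mx Num.conj y)^T.
rewrite !E => h; rewrite rmorphM /= !l2norm_sqr !rmorph_sum /=.
have -> : \sum_i x i ord0 * y i ord0 = 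
          \sum_i x i ord0 * (((map_mx Num.conj y) i ord0)^*)%R.
  by apply: eq_bigr => i _; rewrite mxE conjCK.
apply: le_trans h _; rewrite le_eqVlt; apply/orP; left; apply/eqP.
congr (_ * _).
  by apply: eq_bigr => i _; rewrite modulus_sqrC.
by apply: eq_bigr => i _; rewrite modulus_sqrC.
Qed.

End L2norm.

(** * The operator norm *)

Section Opnorm.
Context {R : realType} {n : nat}.
Implicit Types (A D : 'M[R[i]]_n) (x y : 'cV[R[i]]_n).

Lemma l2norm_mulmx_bounded A x : l2norm x <= 1 ->
  l2norm (A *m x) <= \sum_i \sum_j modulus (A i j).
Proof.
move=> x1; apply: le_trans (l2norm_le_sum _) _; apply: ler_sum => i _.
rewrite mxE; apply: le_trans (modulus_sum _) _; apply: ler_sum => j _.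
rewrite modulusM ler_piMr ?modulus_ge0 //.
exact: le_trans (modulus_le_l2norm _ _) _.
Qed.

Lemma opnorm_le A (K : R) : 0 <= K ->
  (forall x, l2norm x <= 1 -> l2norm (A *m x) <= K) -> opnorm A <= K.
Proof. by move=> K0 AK; apply: sup_le_ge0 => // _ [x /AK + <-]. Qed.

Lemma opnorm_le_sum A : opnorm A <= \sum_i \sum_j modulus (A i j).
Proof.
apply: opnorm_le; last exact: l2norm_mulmx_bounded.
by do 2 (rewrite sumr_ge0 // => ? _); exact: modulus_ge0.
Qed.

Lemma l2norm_le_opnorm A x : l2norm x <= 1 -> l2norm (A *m x) <= opnorm A.
Proof.
move=> x1; apply: ub_le_sup; last by exists x.
exists (\sum_i \sum_j modulus (A i j)) => _ [y y1 <-].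
exact: l2norm_mulmx_bounded.
Qed.

Lemma opnorm_ge0 A : 0 <= opnorm A.
Proof.
apply: le_trans (l2norm_le_opnorm A (x := 0) _); first exact: l2norm_ge0.
by rewrite l2norm0.
Qed.

Lemma l2norm_mulmx A x : l2norm (A *m x) <= opnorm A * l2norm x.
Proof.
have [/l2norm_eq0 ->|x0] := eqVneq (l2norm x) 0.
  by rewrite mulmx0 l2norm0 mulr0.
have xp : 0 < l2norm x by rewrite lt_def x0 l2norm_ge0.
rewrite -ler_pdivrMr //.
have x1 : l2norm (((l2norm x)^-1)%:C *: x) <= 1 by rewrite l2norm_normalize.
have := l2norm_le_opnorm A x1.
by rewrite -scalemxAr l2normZ modulus_real ?invr_ge0 ?l2norm_ge0 // mulrC.
Qed.

Lemma bilinear_formE D x y :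
  \sum_i \sum_j D i j * x i ord0 * y j ord0 = \sum_i x i ord0 * (D *m y) i ord0.
Proof.
apply: eq_bigr => i _; rewrite mxE mulr_sumr; apply: eq_bigr => j _.
by rewrite (mulrC (D i j)) mulrA.
Qed.

Lemma modulus_form_le D x y :
  modulus (\sum_i \sum_j D i j * x i ord0 * y j ord0) <=
  opnorm D * (l2norm x * l2norm y).
Proof.
rewrite bilinear_formE; apply: le_trans (l2norm_Cauchy_Schwarz _ _) _.
by rewrite mulrCA ler_wpM2l ?l2norm_ge0 // l2norm_mulmx.
Qed.

Lemma modulus_entry_le_opnorm D i j : modulus (D i j) <= opnorm D.
Proof.
apply: le_trans (l2norm_le_opnorm D (x := delta_mx j ord0) _); last first.
  by rewrite l2norm_delta.
by rewrite -colE; apply: le_trans (modulus_le_l2norm _ i); rewrite mxE.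
Qed.

(** Conjugation is an isometry of the Euclidean space. *)
Lemma opnorm_conj D : opnorm (map_mx Num.conj D) <= opnorm D.
Proof.
apply: opnorm_le; first exact: opnorm_ge0.
move=> x x1; rewrite -l2norm_conj map_mxM -map_mx_comp (map_mx_id (@conjCK _)).
by apply: l2norm_le_opnorm; rewrite l2norm_conj.
Qed.

End Opnorm.

(** * Singular values, and the duality of the trace and operator norms *)

(** Bilinear rather than sesquilinear: Schur multiplication then passes from one
argument to the other without conjugating the multiplier. *)
Definition pairing (R : realType) (n : nat) (D X : 'M[R[i]]_n) : R[i] :=
  \sum_i \sum_j D i j * X i j.

Section Schatten.
Local Open Scope sesquilinear_scope.
Context {R : realType} {n : nat}.
Implicit Types (A D X Y P : 'M[R[i]]_n).

Lemma singular_value_ge0 A i : 0 <= singular_value A i.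
Proof. exact: sqrtr_ge0. Qed.

Lemma gram_diag Y (i : 'I_n) : (Y ^t* *m Y) i i = ((l2norm (col i Y)) ^+ 2)%:C.
Proof. by rewrite l2norm_sqrC !mxE; apply: eq_bigr => k _; rewrite !mxE. Qed.

(** Diagonalise [A ^t* *m A] by a unitary [P] and put [Y = A *m P ^t*]: the
columns of [Y] are orthogonal and their norms are the singular values.  They are
not normalised, so that zero singular values need no case distinction. *)
Lemma singular_value_decomposition A : exists Y P,
  [/\ P \is unitarymx, A = Y *m P &
      Y ^t* *m Y = diag_mx (\row_i ((singular_value A i) ^+ 2)%:C)].
Proof.
set G := A ^t* *m A; set P := spectralmx G.
have GE : G = P ^t* *m diag_mx (spectral_diag G) *m P.
  have Gherm : G \is hermsymmx.
    apply/is_hermitianmxP; rewrite expr0 scale1r /G trmx_mul map_mxM /=.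
    by rewrite trmxCK.
  have /hermitian_normalmx/orthomx_spectralP := Gherm.
  by rewrite invmx_unitary // spectral_unitarymx.
have Pu : P \is unitarymx by exact: spectral_unitarymx.
have YE : (A *m P ^t*) ^t* *m (A *m P ^t*) = diag_mx (spectral_diag G).
  rewrite trmx_mul map_mxM /= trmxCK mulmxA -(mulmxA P) -/G {1}GE !mulmxA.
  by rewrite (unitarymxP Pu) mul1mx -mulmxA (unitarymxP Pu) mulmx1.
exists (A *m P ^t*), P; split => //; first by rewrite mulmxKtV.
rewrite YE; congr diag_mx; apply/rowP => i; rewrite mxE.
have : spectral_diag G ord0 i = ((l2norm (col i (A *m P ^t*))) ^+ 2)%:C.
  by rewrite -gram_diag YE mxE eqxx mulr1n.
rewrite /singular_value -/G => ->.
rewrite -[complex.Re _]/(l2norm _ ^+ 2) (@sqr_sqrtr _ (l2norm _ ^+ 2)) //.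
by rewrite exprn_ge0 ?l2norm_ge0.
Qed.

(** Pythagoras, for the orthogonal columns of [Y]. *)
Lemma l2norm_gram Y (c : 'I_n -> R) (y : 'cV[R[i]]_n) :
  Y ^t* *m Y = diag_mx (\row_i (c i)%:C) ->
  l2norm (Y *m y) ^+ 2 = \sum_i c i * modulus (y i ord0) ^+ 2.
Proof.
move=> YE; apply: complexI; rewrite l2norm_sqrC trmx_mul map_mxM /= mulmxA.
rewrite -(mulmxA _ _ Y) YE mxE rmorph_sum /=; apply: eq_bigr => i _.
rewrite mul_mx_diag rmorphM /= modulus_sqrC !mxE.
by rewrite mulrAC mulrC; congr (_ * _); rewrite mulrC.
Qed.

Lemma schatten1E A : schatten_norm 1 A = \sum_i singular_value A i.
Proof.
rewrite /schatten_norm invr1 powRr1.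
  by apply: eq_bigr => i _; rewrite powRr1 ?singular_value_ge0.
by rewrite sumr_ge0 // => i _; rewrite powR_ge0.
Qed.

Lemma schatten1_ge0 A : 0 <= schatten_norm 1 A.
Proof. exact: powR_ge0. Qed.

Lemma schatten2_ge0 A : 0 <= schatten_norm 2 A.
Proof. exact: powR_ge0. Qed.

(** Both sides are the trace of [A ^t* *m A]. *)
Lemma schatten2_sqr A :
  schatten_norm 2 A ^+ 2 = \sum_i \sum_j modulus (A i j) ^+ 2.
Proof.
have -> : schatten_norm 2 A ^+ 2 = \sum_i singular_value A i ^+ 2.
  rewrite /schatten_norm -powR_mulrn ?powR_ge0 // -powRrM.
  rewrite mulVf ?pnatr_eq0 // powRr1.
    by apply: eq_bigr => i _; rewrite powR_mulrn ?singular_value_ge0.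
  by rewrite sumr_ge0 // => i _; rewrite powR_ge0.
have [Y [P [Pu AE YE]]] := singular_value_decomposition A.
apply: complexI; transitivity (\tr (A ^t* *m A)).
  rewrite AE trmx_mul map_mxM /= -mulmxA mxtrace_mulC -!mulmxA.
  rewrite (unitarymxP Pu) mulmx1 YE rmorph_sum /=; apply: eq_bigr => i _.
  by rewrite !mxE eqxx mulr1n -AE.
rewrite exchange_big rmorph_sum /=; apply: eq_bigr => j _.
rewrite mxE rmorph_sum /=.
by apply: eq_bigr => i _; rewrite modulus_sqrC !mxE mulrC.
Qed.

Lemma l2norm_row_unitary P k : P \is unitarymx -> l2norm (row k P)^T = 1.
Proof.
move=> /unitarymxP Pu; apply: (@pexpIrn _ 2); rewrite ?nnegrE ?l2norm_ge0 //.
apply: complexI; rewrite l2norm_sqrC expr1n.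
have /matrixP/(_ k k) := Pu; rewrite !mxE eqxx mulr1n; apply: etrans.
by apply: eq_bigr => i _; rewrite !mxE mulrC.
Qed.

(** With [Y] and [P] as in [singular_value_decomposition], [X] is the sum over k
of (k-th column of [Y]) * (k-th row of [P]).  Each rank-one term pairs with [D]
to at most [opnorm D] times the k-th singular value. *)
Lemma modulus_pairing_le D X :
  modulus (pairing D X) <= opnorm D * schatten_norm 1 X.
Proof.
have [Y [P [Pu XE YE]]] := singular_value_decomposition X.
have -> : pairing D X =
    \sum_k \sum_i \sum_j D i j * (col k Y) i ord0 * ((row k P)^T) j ord0.
  rewrite exchange_big; apply: eq_bigr => i _ /=.
  rewrite exchange_big; apply: eq_bigr => j _ /=.
  by rewrite {1}XE mxE mulr_sumr; apply: eq_bigr => k _; rewrite !mxE mulrA.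
rewrite schatten1E mulr_sumr.
apply: le_trans (modulus_sum _) _; apply: ler_sum => k _.
apply: le_trans (modulus_form_le _ _ _) _.
rewrite l2norm_row_unitary // mulr1 ler_wpM2l ?opnorm_ge0 //.
rewrite -(@ler_pXn2r _ 2) // ?nnegrE ?l2norm_ge0 ?singular_value_ge0 //.
by rewrite -lecR -gram_diag YE !mxE eqxx mulr1n.
Qed.

(** Let [X = Y *m P] as in [singular_value_decomposition].  Normalising the
nonzero columns of [Y] turns this product into the partial isometry [W] of the
polar decomposition of [X].  It is a contraction, and the pairing of its
conjugate with [X] is the trace of [W ^t* *m X], the sum of the singular
values. *)
Lemma schatten1_attained X :
  exists2 D, opnorm D <= 1 & modulus (pairing D X) = schatten_norm 1 X.
Proof.
have [Y [P [Pu XE YE]]] := singular_value_decomposition X.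
set s := singular_value X in YE.
(* Inverting the singular values normalises the columns of Y; as 0^-1 = 0, the
   zero columns are kept. *)
pose S := diag_mx (\row_i ((s i)^-1)%:C) : 'M[R[i]]_n.
have SE : S ^t* = S.
  apply/matrixP => i j; rewrite !mxE eq_sym.
  case: eqP => [->|_]; last by rewrite !mulr0n conjC0.
  by rewrite !mulr1n; apply: conj_Creal; rewrite complex_real.
pose W := Y *m S *m P.
exists (map_mx Num.conj W).
  apply: le_trans (opnorm_conj _) _; apply: opnorm_le => // x x1.
  rewrite -(@ler_pXn2r _ 2) // ?nnegrE ?l2norm_ge0 // expr1n.
  (* The Gram matrix of Y *m S is the projection onto the nonzero singular
     values. *)
  rewrite -mulmxA (@l2norm_gram _ (fun i => (s i != 0)%:R)); last first.
    rewrite trmx_mul map_mxM /= SE mulmxA -(mulmxA S) YE.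
    rewrite /S !mulmx_diag; congr diag_mx; apply/rowP => i; rewrite !mxE.
    rewrite -!rmorphM /=; congr (_%:C).
    have [->|s0] := eqVneq (s i) 0; first by rewrite invr0 mulr0.
    by rewrite -mulrA expr2 -(mulrA (s i)) mulfV // mulr1 mulVf.
  apply: (@le_trans _ _ (l2norm (P *m x) ^+ 2)).
    rewrite l2norm_sqr; apply: ler_sum => i _.
    rewrite ler_piMl ?exprn_ge0 ?modulus_ge0 //.
    by case: (_ != _); rewrite ?ler01.
  rewrite l2norm_isometry ?expr_le1 ?l2norm_ge0 //.
  apply/eqP; have : P ^t* \is unitarymx by rewrite trmxC_unitary.
  by rewrite qualifE /= trmxCK.
suff -> : pairing (map_mx Num.conj W) X = (schatten_norm 1 X)%:C.
  by rewrite modulus_real ?schatten1_ge0.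
transitivity (\tr (W ^t* *m X)).
  rewrite /pairing exchange_big; apply: eq_bigr => j _ /=; rewrite mxE.
  by apply: eq_bigr => i _; rewrite !mxE.
rewrite /W XE !(trmx_mul, map_mxM) /= SE -mulmxA mxtrace_mulC !mulmxA.
rewrite mulmxtVK // -mulmxA YE mulmx_diag -XE schatten1E rmorph_sum /=.
apply: eq_bigr => i _; rewrite !mxE eqxx mulr1n -rmorphM /=; congr (_%:C).
have [s0|s0] := eqVneq (s i) 0; first by rewrite s0 invr0 mul0r -/s s0.
by rewrite expr2 mulrA mulVf // mul1r.
Qed.

End Schatten.

(** * Linear and bilinear Schur multipliers *)

Section SchurMultipliers.
Local Open Scope sesquilinear_scope.
Context {R : realType} {n : nat}.
Implicit Types (A B C D S : 'M[R[i]]_n) (m : 'I_n -> 'I_n -> 'I_n -> R[i]).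

Lemma sum_delta_mxE (F : 'I_n -> 'I_n -> R[i]) i j :
  (\sum_a \sum_b F a b *: delta_mx a b : 'M[R[i]]_n) i j = F i j.
Proof.
have /matrixP/(_ i j) := matrix_sum_delta (\matrix_(a, b) F a b).
rewrite mxE => ->; congr (fun_of_matrix _ i j).
by do 2 (apply: eq_bigr => ? _); rewrite mxE.
Qed.

Lemma linear_schurE S C i j : linear_schur S C i j = S i j * C i j.
Proof. exact: (sum_delta_mxE (fun a b => S a b * C a b)). Qed.

Lemma bilinear_schurE m A B i j :
  bilinear_schur m A B i j = \sum_k m i k j * A i k * B k j.
Proof.
rewrite -[RHS](sum_delta_mxE (fun a b => \sum_k m a k b * A a k * B k b)).
congr (fun_of_matrix _ i j); apply: eq_bigr => a _; rewrite exchange_big.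
by apply: eq_bigr => b _; rewrite scaler_suml.
Qed.

Local Notation schur_norm S :=
  (linear_norm (@opnorm R n) (@opnorm R n) (linear_schur S)).

(** Entries of a contraction have modulus at most 1. *)
Lemma opnorm_schur_bounded S C : opnorm C <= 1 ->
  opnorm (linear_schur S C) <= \sum_i \sum_j modulus (S i j).
Proof.
move=> C1; apply: le_trans (opnorm_le_sum _) _.
do 2 (apply: ler_sum => ? _); rewrite linear_schurE modulusM.
by rewrite ler_piMr ?modulus_ge0 // (le_trans (modulus_entry_le_opnorm _ _ _)).
Qed.

Lemma opnorm_schur_le S C : opnorm C <= 1 ->
  opnorm (linear_schur S C) <= schur_norm S.
Proof.
move=> C1; apply: ub_le_sup; last by exists C.
exists (\sum_i \sum_j modulus (S i j)) => _ [D D1 <-].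
exact: opnorm_schur_bounded.
Qed.

Lemma schur_norm_ge0 S : 0 <= schur_norm S.
Proof.
apply: (@sup_ge0 _ _ (\sum_i \sum_j modulus (S i j))).
  by move=> _ [C _ <-]; exact: opnorm_ge0.
by move=> _ [C C1 <-]; exact: opnorm_schur_bounded.
Qed.

(** The identity linking the two sides of the theorem: paired against [D], the
trilinear form splits over the summed index into forms of the matrices obtained
from [D] by the linear Schur multipliers of the slices. *)
Lemma pairing_bilinear_schur m A B D :
  pairing D (bilinear_schur m A B) =
  \sum_k \sum_i \sum_j linear_schur (schur_slice m k) D i j
                       * col k A i ord0 * ((row k B)^T) j ord0.
Proof.
rewrite exchange_big; apply: eq_bigr => i _ /=.
rewrite exchange_big; apply: eq_bigr => j _ /=.
rewrite bilinear_schurE mulr_sumr; apply: eq_bigr => k _.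
by rewrite linear_schurE !mxE !mulrA (mulrC (D i j)).
Qed.

Lemma schatten1_bilinear_schur_le m (K : R) A B :
  0 <= K -> (forall k, schur_norm (schur_slice m k) <= K) ->
  schatten_norm 2 A <= 1 -> schatten_norm 2 B <= 1 ->
  schatten_norm 1 (bilinear_schur m A B) <= K.
Proof.
move=> K0 mK A1 B1.
have [D D1 <-] := schatten1_attained (bilinear_schur m A B).
rewrite pairing_bilinear_schur; apply: le_trans (modulus_sum _) _.
have colA : \sum_k l2norm (col k A) ^+ 2 = schatten_norm 2 A ^+ 2.
  rewrite schatten2_sqr exchange_big; apply: eq_bigr => k _.
  by rewrite l2norm_sqr; apply: eq_bigr => i _; rewrite mxE.
have rowB : \sum_k l2norm (row k B)^T ^+ 2 = schatten_norm 2 B ^+ 2.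
  rewrite schatten2_sqr; apply: eq_bigr => k _.
  by rewrite l2norm_sqr; apply: eq_bigr => i _; rewrite !mxE.
(* The AM-GM inequality suffices, both S^2 norms being at most 1. *)
apply: (@le_trans _ _
    (\sum_k K * ((l2norm (col k A) ^+ 2 + l2norm (row k B)^T ^+ 2) / 2))).
  apply: ler_sum => k _; apply: le_trans (modulus_form_le _ _ _) _.
  apply: ler_pM; rewrite ?opnorm_ge0 ?mulr_ge0 ?l2norm_ge0 //.
    exact: le_trans (opnorm_schur_le _ D1) (mK k).
  rewrite ler_pdivlMr // -subr_ge0.
  rewrite (_ : _ - _ = (l2norm (col k A) - l2norm (row k B)^T) ^+ 2).
    exact: sqr_ge0.
  by rewrite sqrrB mulr_natr addrAC.
rewrite -mulr_sumr ler_piMr // -mulr_suml big_split /= colA rowB.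
have sqr_le1 (X : 'M[R[i]]_n) :
    schatten_norm 2 X <= 1 -> schatten_norm 2 X ^+ 2 <= 1.
  by move=> X1; rewrite expr_le1 ?schatten2_ge0.
by rewrite ler_pdivrMr // mul1r; apply: lerD; exact: sqr_le1.
Qed.

Lemma schatten2_le1 (A : 'M[R[i]]_n) :
  \sum_i \sum_j modulus (A i j) ^+ 2 <= 1 -> schatten_norm 2 A <= 1.
Proof.
rewrite -schatten2_sqr -[X in _ <= X](expr1n _ 2).
by rewrite ler_pXn2r ?nnegrE ?schatten2_ge0.
Qed.

Lemma schur_norm_le m (K : R) k :
  (forall A B, schatten_norm 2 A <= 1 -> schatten_norm 2 B <= 1 ->
     schatten_norm 1 (bilinear_schur m A B) <= K) ->
  schur_norm (schur_slice m k) <= K.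
Proof.
move=> mK.
have K0 : 0 <= K.
  have z1 : schatten_norm 2 (0 : 'M[R[i]]_n) <= 1.
    apply: schatten2_le1; rewrite big1 // => i _; rewrite big1 // => j _.
    by rewrite mxE modulus0 expr0n.
  exact: le_trans (schatten1_ge0 _) (mK _ _ z1 z1).
apply: sup_le_ge0 => // _ [C C1 <-]; apply: opnorm_le => // x x1.
set y := _ *m x; have [->|y0] := eqVneq (l2norm y) 0; first exact: K0.
(* The unit vector for which u^T y is the norm of y. *)
pose u : 'cV[R[i]]_n := ((l2norm y)^-1)%:C *: map_mx Num.conj y.
have u1 : l2norm u = 1.
  by rewrite l2normZ l2norm_conj modulus_real ?mulVf // invr_ge0 l2norm_ge0.
pose A := \matrix_(i, l) (if l == k then u i ord0 else 0).
pose B := \matrix_(l, j) (if l == k then x j ord0 else 0).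
have A1 : schatten_norm 2 A <= 1.
  apply: schatten2_le1; rewrite exchange_big (bigD1 k) //=.
  rewrite [X in _ + X]big1 ?addr0; last first.
    move=> l /negPf lk; rewrite big1 // => i _.
    by rewrite mxE lk modulus0 expr0n.
  apply: (@le_trans _ _ (l2norm u ^+ 2)); last by rewrite u1 expr1n.
  rewrite le_eqVlt; apply/orP; left; apply/eqP.
  by rewrite l2norm_sqr; apply: eq_bigr => i _; rewrite mxE eqxx.
have B1 : schatten_norm 2 B <= 1.
  apply: schatten2_le1; rewrite (bigD1 k) //=.
  rewrite [X in _ + X]big1 ?addr0; last first.
    move=> l /negPf lk; rewrite big1 // => i _.
    by rewrite mxE lk modulus0 expr0n.
  apply: (@le_trans _ _ (l2norm x ^+ 2)); last by rewrite expr_le1 ?l2norm_ge0.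
  rewrite le_eqVlt; apply/orP; left; apply/eqP.
  by rewrite l2norm_sqr; apply: eq_bigr => i _; rewrite mxE eqxx.
apply: le_trans (mK A B A1 B1).
suff <- : modulus (pairing C (bilinear_schur m A B)) = l2norm y.
  apply: le_trans (modulus_pairing_le _ _) _.
  by rewrite ler_piMl ?schatten1_ge0.
rewrite pairing_bilinear_schur (bigD1 k) //= [X in _ + X]big1 ?addr0; last first.
  move=> l /negPf lk; rewrite big1 // => i _; rewrite big1 // => j _.
  by rewrite !mxE lk mulr0.
have -> : col k A = u by apply/colP => i; rewrite !mxE eqxx.
have -> : (row k B)^T = x by apply/colP => j; rewrite !mxE eqxx.
rewrite bilinear_formE -/y.
have -> : \sum_i u i ord0 * y i ord0 = ((l2norm y)^-1 * l2norm y ^+ 2)%:C.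
  rewrite rmorphM /= l2norm_sqrC mxE mulr_sumr; apply: eq_bigr => i _.
  by rewrite [u i _]mxE mulrA !mxE.
rewrite expr2 mulrA mulVf // mul1r.
by rewrite modulus_real // l2norm_ge0.
Qed.

End SchurMultipliers.

(** * The norm of a bilinear Schur multiplier *)

Theorem theorem6 (R : realType) (n : nat)
    (m : 'I_n -> 'I_n -> 'I_n -> R[i]) :
  bilinear_norm (schatten_norm 2) (schatten_norm 2) (schatten_norm 1)
    (bilinear_schur m)
  = sup [set linear_norm (@opnorm R n) (@opnorm R n)
               (linear_schur (schur_slice m k)) | k in [set: 'I_n]].
Proof.
set S := [set _ | _ in _].
pose N k := linear_norm (@opnorm R n) (@opnorm R n)
              (linear_schur (schur_slice m k)).
have Sge0 x : S x -> 0 <= x by case=> k _ <-; exact: schur_norm_ge0.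
have Sub : ubound S (\sum_k N k).
  move=> _ [k _ <-]; rewrite (bigD1 k) //= lerDl sumr_ge0 // => l _.
  exact: schur_norm_ge0.
have supS0 : 0 <= sup S := sup_ge0 Sge0 Sub.
have upper A B : schatten_norm 2 A <= 1 -> schatten_norm 2 B <= 1 ->
    schatten_norm 1 (bilinear_schur m A B) <= sup S.
  apply: schatten1_bilinear_schur_le => // k.
  by apply: ub_le_sup; [exists (\sum_k N k) | exists k].
(* The upper bound also shows that the supremum defining the bilinear norm is
   over a bounded set. *)
have le_bilinear A B : schatten_norm 2 A <= 1 -> schatten_norm 2 B <= 1 ->
    schatten_norm 1 (bilinear_schur m A B) <=
    bilinear_norm (schatten_norm 2) (schatten_norm 2) (schatten_norm 1)
      (bilinear_schur m).
  move=> A1 B1; apply: ub_le_sup; last first.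
    by exists (A, B); first exact: conj A1 B1.
  by exists (sup S) => _ [[A' B'] /= [A'1 B'1] <-]; exact: upper.
apply/eqP; rewrite eq_le; apply/andP; split.
  by apply: sup_le_ge0 => // _ [[A B] /= [A1 B1] <-]; exact: upper.
apply: sup_le_ge0.
  apply: (@sup_ge0 _ _ (sup S)) => _ [[A B] /= [A1 B1] <-].
    exact: schatten1_ge0.
  exact: upper.
by move=> _ [k _ <-]; exact: schur_norm_le.
Qed.
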